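(* Let $X=(X_t)_{t\in\mathbb{Z}}$ be a strictly stationary, regularly varying time series with tail process $Y=(Y_t)_{t\in\mathbb{Z}}$, and for $I\subset\mathbb{Z}$ let $\mu_I$ denote the law of $(Y_i)_{i\in I}$. Assume $\mu_{\{-1,0\}}([0,1]\times(1,\infty))>0$ and that for every $l\in\mathbb{N}$ $$\mu_{\{-1,\ldots,l\}}\{(x_i)_{i=-1}^l\in[0,\infty)^{l+2}:\ x_i=0\text{ or }x_i=1\text{ for some }i=-1,\ldots,l\}=0.$$ For a threshold $u$ let the $u$-exceedance cluster size $C_u$ have the distribution $$\mathbb{P}(C_u=l)=\frac{\mathbb{P}(X_{-1}\le u,\,X_0>u,\ldots,X_{l-1}>u,\,X_l\le u)}{\mathbb{P}(X_{-1}\le u,\,X_0>u)},\qquad l\in\mathbb{N}.$$ Then, for every $l\in\mathbb{N}$, $$\lim_{u\to\infty}\mathbb{P}(C_u=l)=\frac{\mathbb{P}(Y_{-1}\le 1,\,Y_0>1,\ldots,Y_{l-1}>1,\,Y_l\le 1)}{\mathbb{P}(Y_{-1}\le 1,\,Y_0>1)}=\frac{\mu_{\{-1,\ldots,l\}}([0,1]\times(1,\infty)^l\times[0,1])}{\mu_{\{-1,0\}}([0,1]\times(1,\infty))}.$$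
   Context: $\mathbb{N}=\{1,2,\ldots\}$. Standing assumptions: $X$ is strictly stationary, its marginal distribution function $F_0$ has a finite lower endpoint and lies in the max-domain of attraction of the $\alpha$-Fréchet distribution $\Phi_\alpha(x)=\exp(-x^{-\alpha})$, $x>0$, for some $\alpha>0$. A random vector $\mathbf{X}$ in $\mathbb{R}^d$ is multivariate regularly varying with index $\alpha>0$ if for some norm $\|\cdot\|$ there is a probability measure $\sigma$ on $\{\mathbf{x}\in[0,\infty)^d:\|\mathbf{x}\|=1\}$ such that, for $r>0$, $\mathbb{P}(\|\mathbf{X}\|>rx,\ \mathbf{X}/\|\mathbf{X}\|\in\cdot)/\mathbb{P}(\|\mathbf{X}\|>x)$ converges weakly to $r^{-\alpha}\sigma(\cdot)$ as $x\to\infty$. The time series $X$ is regularly varying if all its finite-dimensional margins are multivariate regularly varying; equivalently, there is a process $Y=(Y_t)_{t\in\mathbb{Z}}$, called the tail process of $X$, with $\mathbb{P}(Y_0>y)=y^{-\alpha}$ for $y\ge1$ such that for all integers $s<t$ the conditional law of $(X_s/x,\ldots,X_t/x)$ given $X_0>x$ converges weakly to the law of $(Y_s,\ldots,Y_t)$ as $x\to\infty$. A realization of $(X_i)_{i=t}^{t+l-1}$ is a $u$-exceedance cluster of size $l$ if $X_{t-1}\le u$, $X_t>u,\ldots,X_{t+l-1}>u$ and $X_{t+l}\le u$; the distribution of $C_u$ is that of the size of a randomly selected $u$-exceedance cluster, given by the displayed formula. *)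

(* Defs.v *)
From HB Require Import structures.
From mathcomp Require Import all_boot all_order all_algebra.
From mathcomp Require Import all_classical all_reals all_analysis.

Set Implicit Arguments.
Unset Strict Implicit.
Unset Printing Implicit Defensive.

Import Order.TTheory GRing.Theory Num.Theory.
Import numFieldNormedType.Exports.

Local Open Scope classical_set_scope.
Local Open Scope ring_scope.

(* Random vectors take their values in [n.-tuple R], which
   carries the product (= Borel) sigma-algebra; the Euclidean topology and the
   vector space structure are those of ['rV[R]_n], reached through [vec]. *)
Definition vec (R : realType) (n : nat) (t : n.-tuple R) : 'rV[R]_n :=
  \row_i tnth t i.

Definition scale_tuple (R : realType) (n : nat) (a : R) (t : n.-tuple R) :
    n.-tuple R :=
  [tuple a * tnth t i | i < n].

Definition prob d (T : measurableType d) (R : realType) (P : probability T R)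
    (A : set T) : R :=
  fine (P A).

Section fidi.
Context d (T : measurableType d) (R : realType) (P : probability T R).

Definition fidi (X : int -> {RV P >-> R}) (n : nat) (ts : n.-tuple int) :
    T -> n.-tuple R :=
  fun w => [tuple X (tnth ts i) w | i < n].

Lemma measurable_fidi X n (ts : n.-tuple int) :
  measurable_fun [set: T] (fidi X ts).
Proof.
apply/measurable_fun_tnthP => i.
rewrite (_ : _ \o _ = X (tnth ts i)); first exact: measurable_funPT.
by apply/funext => w /=; rewrite tnth_mktuple.
Qed.

HB.instance Definition _ X n (ts : n.-tuple int) :=
  @isMeasurableFun.Build _ _ _ _ (fidi X ts) (measurable_fidi X ts).

Definition fidi_law (X : int -> {RV P >-> R}) n (ts : n.-tuple int) :
    probability (n.-tuple R) R :=
  distribution P (fidi X ts : {RV P >-> n.-tuple R}).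

(* The equality is required on measurable sets only: the value of a measure on
   the other sets is unspecified. *)
Definition strictly_stationary (X : int -> {RV P >-> R}) : Prop :=
  forall (n : nat) (ts : n.-tuple int) (h : int) (A : set (n.-tuple R)),
    measurable A ->
    fidi_law X [tuple tnth ts i + h | i < n] A = fidi_law X ts A.

End fidi.

(* The times s, s + 1, ..., s + n - 1. *)
Definition segment (s : int) (n : nat) : n.-tuple int :=
  [tuple s + (i : nat)%:Z | i < n].

(* A measure enters only through its values on measurable sets, so families of
   plain set functions are allowed here. *)
Definition weak_cvg_pinfty (R : realType) (n : nat)
    (m : R -> set (n.-tuple R) -> \bar R)
    (m0 : set (n.-tuple R) -> \bar R) : Prop :=
  forall f : 'rV[R]_n -> R,
    continuous f -> (exists M : R, forall v, `|f v| <= M) ->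
    (\int[m x]_t (f (vec t))%:E)%E @[x --> +oo]
      --> (\int[m0]_t (f (vec t))%:E)%E.

Definition lower_endpoint_finite (R : realType) (F : R -> R) : Prop :=
  has_lbound [set x | 0 < F x].

Definition frechet (R : realType) (alpha x : R) : R :=
  if 0 < x then expR (- (x `^ (- alpha))) else 0.

(* Convergence at every point is convergence in distribution, since the
   Frechet distribution function is continuous. *)
Definition frechet_MDA (R : realType) (F : R -> R) (alpha : R) : Prop :=
  exists (a b : nat -> R), (forall n, 0 < a n) /\
    forall x : R, F (a n * x + b n) ^+ n @[n --> \oo] --> frechet alpha x.

Definition marginal_df d (T : measurableType d) (R : realType)
    (P : probability T R) (X : int -> {RV P >-> R}) : R -> R :=
  fun x => fine (cdf (X 0) x).

Definition is_norm (R : realType) (n : nat) (N : 'rV[R]_n -> R) : Prop :=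
  [/\ forall u v, N (u + v) <= N u + N v,
      forall (a : R) v, N (a *: v) = `|a| * N v &
      forall v, N v = 0 -> v = 0].

(* The limit measure sigma lives on the nonnegative part of the unit sphere;
   Z may have negative components, so weak convergence is that of measures on
   the whole of R^n. *)
Definition multivariate_regularly_varying d (T : measurableType d)
    (R : realType) (P : probability T R) (n : nat) (Z : T -> n.-tuple R)
    (alpha : R) : Prop :=
  exists N : 'rV[R]_n -> R, is_norm N /\
  exists sigma : probability (n.-tuple R) R,
    sigma [set t | (forall i, 0 <= tnth t i) /\ N (vec t) = 1] = 1%E /\
    forall r : R, 0 < r ->
      weak_cvg_pinfty
        (fun x B =>
          (prob P [set w | r * x < N (vec (Z w)) /\
                           B (scale_tuple (N (vec (Z w)))^-1 (Z w))] /
           prob P [set w | x < N (vec (Z w))])%:E)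
        (fun B => ((r `^ (- alpha))%:E * sigma B)%E).

Definition regularly_varying d (T : measurableType d) (R : realType)
    (P : probability T R) (X : int -> {RV P >-> R}) (alpha : R) : Prop :=
  forall (n : nat) (ts : n.-tuple int), (0 < n)%N -> uniq ts ->
    multivariate_regularly_varying P (fidi X ts) alpha.

(* Integers s < t are given by s and the number n = t - s + 1 >= 2 of times. *)
Definition tail_process d (T : measurableType d) d' (T' : measurableType d')
    (R : realType) (P : probability T R) (P' : probability T' R)
    (X : int -> {RV P >-> R}) (Y : int -> {RV P' >-> R}) (alpha : R) : Prop :=
  (forall y : R, 1 <= y -> prob P' [set w | y < Y 0 w] = y `^ (- alpha)) /\
  (forall (s : int) (n : nat), (2 <= n)%N ->
    weak_cvg_pinfty
      (fun x B =>
        (prob P [set w | x < X 0 w /\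
                         B (scale_tuple x^-1 (fidi X (segment s n) w))] /
         prob P [set w | x < X 0 w])%:E)
      (fidi_law Y (segment s n))).

Definition start_event d (T : measurableType d) (R : realType)
    (P : probability T R) (Z : int -> {RV P >-> R}) (u : R) : set T :=
  [set w | Z (-1) w <= u /\ u < Z 0 w].

Definition cluster_event d (T : measurableType d) (R : realType)
    (P : probability T R) (Z : int -> {RV P >-> R}) (u : R) (l : nat) : set T :=
  [set w | [/\ Z (-1) w <= u,
               forall i : nat, (i < l)%N -> u < Z i%:Z w &
               Z l%:Z w <= u]].

Definition cluster_size_law d (T : measurableType d) d' (T' : measurableType d')
    (R : realType) (P : probability T R) (Q : probability T' R)
    (X : int -> {RV P >-> R}) (u : R) (C : {RV Q >-> nat}) : Prop :=
  forall l : nat, (1 <= l)%N ->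
    prob Q [set w | C w = l] =
      prob P (cluster_event X u l) / prob P (start_event X u).

(* [0,1] x (1,oo), [0,1] x (1,oo)^l x [0,1], and the nonnegative vectors with
   some coordinate equal to 0 or 1. *)
Definition start_box (R : realType) : set (2.-tuple R) :=
  [set t | 0 <= tnth t ord0 <= 1 /\ 1 < tnth t ord_max].

Definition cluster_box (R : realType) (l : nat) : set (l.+2.-tuple R) :=
  [set t | [/\ 0 <= tnth t ord0 <= 1,
               forall i : 'I_l.+2, (0 < i < l.+1)%N -> 1 < tnth t i &
               0 <= tnth t ord_max <= 1]].

Definition critical_set (R : realType) (n : nat) : set (n.-tuple R) :=
  [set t | (forall i, 0 <= tnth t i) /\
           exists i, tnth t i = 0 \/ tnth t i = 1].

(* Main.v *)
Require Import Defs.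
From HB Require Import structures.
From mathcomp Require Import all_boot all_order all_algebra.
From mathcomp Require Import all_classical all_reals all_analysis.
From mathcomp Require Import measurable_realfun ring lra.

Import Order.TTheory GRing.Theory Num.Theory.
Import numFieldNormedType.Exports.
Import HBNNSimple.

Local Open Scope classical_set_scope.
Local Open Scope ring_scope.

Set Implicit Arguments.
Unset Strict Implicit.
Unset Printing Implicit Defensive.

(** The cluster size probability is the quotient of the conditional probabilities,
    given X_0 > u, of the cluster event and of the start event.  Each of these is a
    condition on which of X_{-1}, ..., X_l exceed u, that is, on which coordinates
    of the rescaled vector X / u exceed 1.  By definition of the tail process, the
    conditional law of that vector converges weakly to the law of
    (Y_{-1}, ..., Y_l), so each conditional probability converges to the
    probability of the same pattern for Y at level 1, as soon as Y almost surely
    avoids the value 1 (weak_cvg_continuity_set and its specialization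
    weak_cvg_threshold).  The quotient converges because the limit of the
    denominator is positive.

    The critical sets and the boxes of the statement consist of nonnegative
    vectors only.  Both are related to Y through its almost sure nonnegativity
    (tail_process_ge0): the marginal law of X is bounded from below, so the negative
    part of X_t / x vanishes in the limit.  Hence the nullity of the critical
    set yields that Y avoids 1 (hits_one_eq0), and the boxes have the
    probabilities of the cluster and start events of Y (cluster_box_law,
    start_box_law). *)

(** * Measurable sets and integrals *)

Lemma measure0_subset d (T : measurableType d) (R : realType)
    (m : {measure set T -> \bar R}) (A B : set T) :
  measurable A -> measurable B -> A `<=` B -> m B = 0%E -> m A = 0%E.
Proof.
move=> mA mB AB mB0; apply/eqP.
by rewrite eq_le measure_ge0 andbT -mB0 le_measure// inE.
Qed.

(** Two events that agree almost surely are exchanged through a measurable null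
    set N containing their symmetric difference: each one is included in the
    union of N and the other. *)
Lemma measure_eq_negligible d (T : measurableType d) (R : realType)
    (m : {measure set T -> \bar R}) (A B : set T) :
  measurable A -> measurable B ->
  {ae m, forall w, A w <-> B w} -> m A = m B.
Proof.
move=> mA mB [N [mN mN0 ABN]].
have half (C D : set T) : measurable C -> measurable D ->
    C `<=` D `|` N -> (m C <= m D)%E.
  move=> mC mD CDN; rewrite -[leRHS]adde0 -mN0.
  apply: le_trans (measureU2 m mD mN).
  by apply: le_measure => //; rewrite inE //; exact: measurableU.
have AB w : ~ N w -> (A w <-> B w) by move=> Nw; apply: contra_notP Nw; exact: ABN.
apply/eqP; rewrite eq_le !half// => w Cw;
  by have [Nw|/AB ABw] := pselect (N w); [right|left; exact/ABw].
Qed.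

(** Only finitely many truth assignments f exist, so the event is the finite
    union, over those satisfying b, of the finite intersections of the events
    on which each p i takes the value f i. *)
Lemma measurable_finpred_preimage d (T : measurableType d) (I : finType)
    (p : I -> T -> bool) (b : (I -> bool) -> Prop) :
  (forall i, measurable [set w | p i w]) ->
  measurable [set w | b (p ^~ w)].
Proof.
move=> mp.
have -> : [set w | b (p ^~ w)] =
    \bigcup_(f in [set f : {ffun I -> bool} | b f])
    \bigcap_(i in [set: I]) [set w | p i w = f i].
  apply/seteqP; split => [w bw|w [f bf fw]] /=.
    exists [ffun i => p i w] => /=; last by move=> i _ /=; rewrite ffunE.
    by rewrite (_ : fun_of_fin _ = p ^~ w)//; apply/funext => i; rewrite ffunE.
  by rewrite (_ : p ^~ w = f)//; apply/funext => i; exact: fw.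
apply: fin_bigcup_measurable => // f _; apply: fin_bigcap_measurable => // i _.
case: (f i); first exact: mp.
rewrite (_ : [set w | _] = ~` [set w | p i w]); first exact/measurableC/mp.
by apply/seteqP; split => w /=; [move=> ->|move=> /negP/negbTE].
Qed.

Lemma measurable_tnth_preimage (R : realType) n (i : 'I_n) (B : set R) :
  measurable B -> measurable [set t : n.-tuple R | B (tnth t i)].
Proof.
have mt : measurable_fun setT (fun t : n.-tuple R => tnth t i).
  exact: measurable_tnth.
by move=> mB; have := mt measurableT B mB; rewrite setTI.
Qed.

Lemma measurable_RV_preimage d (T : measurableType d) (R : realType)
    (P : probability T R) (Z : {RV P >-> R}) (B : set R) :
  measurable B -> measurable [set w | B (Z w)].
Proof.
have mZ : measurable_fun setT Z := measurable_funPT Z.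
by move=> mB; have := mZ measurableT B mB; rewrite setTI.
Qed.

Lemma measurable_RV_le d (T : measurableType d) (R : realType)
    (P : probability T R) (Z : {RV P >-> R}) (u : R) :
  measurable [set w | Z w <= u].
Proof. exact: (measurable_RV_preimage Z (measurable_itv `]-oo, u])). Qed.

Lemma measurable_RV_lt d (T : measurableType d) (R : realType)
    (P : probability T R) (Z : {RV P >-> R}) (u : R) :
  measurable [set w | Z w < u].
Proof. exact: (measurable_RV_preimage Z (measurable_itv `]-oo, u[)). Qed.

Lemma measurable_RV_gt d (T : measurableType d) (R : realType)
    (P : probability T R) (Z : {RV P >-> R}) (u : R) :
  measurable [set w | u < Z w].
Proof.
rewrite (_ : [set w | _] = ~` [set w | Z w <= u]).
  exact/measurableC/measurable_RV_le.
by apply/seteqP; split => w /=; rewrite ltNge => /negP.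
Qed.

Lemma measurable_RV_ge d (T : measurableType d) (R : realType)
    (P : probability T R) (Z : {RV P >-> R}) (u : R) :
  measurable [set w | u <= Z w].
Proof.
rewrite (_ : [set w | _] = ~` [set w | Z w < u]).
  exact/measurableC/measurable_RV_lt.
by apply/seteqP; split => w /=; rewrite leNgt => /negP.
Qed.

(** The tail process is defined with plain set functions as conditional laws.  Simple
    functions have measurable level sets, so an integral sees a set function only
    through its values there, and such a set function can be replaced by a true
    measure. *)
Lemma integral_eq_measurable d (T : measurableType d) (R : realType)
    (m1 m2 : set T -> \bar R) (f : T -> \bar R) :
  (forall A, measurable A -> m1 A = m2 A) ->
  (\int[m1]_x f x = \int[m2]_x f x)%E.
Proof.
move=> m12; rewrite /integral.
have E (h : {nnsfun T >-> R}) : sintegral m1 h = sintegral m2 h.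
  by apply: eq_fsbigr => r _; rewrite m12.
by congr (ereal_sup _ - ereal_sup _)%E; apply: eq_imagel => h _; exact: E.
Qed.

Lemma integral_sandwich d (T : measurableType d) (R : realType)
    (m : {measure set T -> \bar R}) (A : set T) (g h : T -> R) :
  measurable A -> measurable_fun setT g -> measurable_fun setT h ->
  (forall t, 0 <= g t) ->
  (forall t, g t <= \1_A t <= h t) ->
  (\int[m]_t (g t)%:E <= m A <= \int[m]_t (h t)%:E)%E.
Proof.
move=> mA mg mh g0 gAh.
have -> : m A = (\int[m]_t (\1_A t)%:E)%E by rewrite integral_indic// setIT.
apply/andP; split; apply: ge0_le_integral => //.
- by move=> t _; rewrite lee_fin.
- exact/measurable_EFinP.
- by apply/measurable_EFinP/measurable_indic.
- by move=> t _; rewrite lee_fin; have /andP[] := gAh t.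
- by apply/measurable_EFinP/measurable_indic.
- exact/measurable_EFinP.
- by move=> t _; rewrite lee_fin; have /andP[] := gAh t.
Qed.

(** Dominated convergence: the powers q ^ k are bounded by 1 and tend to 0 off the
    null set where q is 1. *)
Lemma cvg_integral_exprn0 d (T : measurableType d) (R : realType)
    (m : probability T R) (q : T -> R) :
  measurable_fun setT q -> (forall t, 0 <= q t <= 1) ->
  m [set t | q t = 1] = 0%E ->
  (\int[m]_t (q t ^+ k)%:E @[k --> \oo] --> 0)%E.
Proof.
move=> mq q01 mq1.
have mq1s : measurable [set t | q t = 1].
  by have := mq measurableT [set 1] (measurable_set1 1); rewrite setTI.
have [] := @dominated_convergence _ _ _ m setT measurableT
  (fun k t => (q t ^+ k)%:E) (cst 0%E) (cst 1%E).
- by move=> k; apply/measurable_EFinP; exact: measurable_funX.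
- exact: measurable_cst.
- exists [set t | q t = 1]; split => // t /=.
  apply: contra_notP => q1 _; apply/(fine_cvgP _ 0); split; first exact: nearW.
  apply: cvg_expr; have /andP[q0 q1'] := q01 t.
  by rewrite ger0_norm// lt_neqAle q1' andbT; apply/eqP.
- exact: finite_measure_integrable_cst.
- apply: aeW => t k _; have /andP[q0 q1'] := q01 t.
  by rewrite gee0_abs lee_fin ?exprn_ge0// exprn_ile1.
- by move=> _ _; rewrite integral0.
Qed.

(** * Weak convergence and continuity sets *)

Lemma weak_cvg_pinfty_eq_measurable (R : realType) n
    (m1 m2 : R -> set (n.-tuple R) -> \bar R) (m0 : set (n.-tuple R) -> \bar R) :
  (forall x A, measurable A -> m1 x A = m2 x A) ->
  weak_cvg_pinfty m1 m0 -> weak_cvg_pinfty m2 m0.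
Proof.
move=> m12 cvg1 f cf bf; have := cvg1 f cf bf.
rewrite (_ : (fun x => _) = (fun x => \int[m2 x]_t (f (vec t))%:E)%E)//.
by apply/funext => x; exact/integral_eq_measurable/m12.
Qed.

(** Off the set where q is 1 the indicator is locally constant; on that set the
    damping factor vanishes and squeezes the product to 0. *)
Lemma continuous_indic_damped (R : realType) (V : topologicalType)
    (B : set V) (q : V -> R) (k : nat) :
  continuous q -> (forall v, 0 <= q v <= 1) ->
  (forall v, q v != 1 -> \forall u \near v, B u <-> B v) ->
  continuous (fun v => \1_B v * (1 - q v ^+ k)).
Proof.
move=> cq q01 Bq v.
have cp : {for v, continuous (fun u => 1 - q u ^+ k)}.
  apply: cvgB; first exact: cvg_cst.
  exact: (continuous_comp (cq v) (@exprn_continuous R k _)).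
have p0 u : 0 <= 1 - q u ^+ k.
  by have /andP[q0 q1] := q01 u; rewrite subr_ge0 exprn_ile1.
have [qv1|qv1] := eqVneq (q v) 1; last first.
  have near_eq : \forall u \near v,
      \1_B v * (1 - q u ^+ k) = \1_B u * (1 - q u ^+ k).
    near=> u; congr (_ * _); rewrite !indicE; congr (nat_of_bool _)%:R.
    have BuBv : B u <-> B v by near: u; exact: Bq.
    by apply/idP/idP; rewrite !inE => /BuBv.
  apply: cvg_trans (near_eq_cvg near_eq) _.
  by apply: cvgM => //; exact: cvg_cst.
have pv0 : 1 - q v ^+ k = 0 by rewrite qv1 expr1n subrr.
rewrite /continuous_at pv0 mulr0.
apply: (squeeze_cvgr (f := cst 0) (h := fun u => 1 - q u ^+ k)).
- near=> u; have b01 : 0 <= (\1_B u : R) <= 1.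
    by rewrite indicE; case: (u \in B); rewrite ?lexx ?ler01.
  have /andP[b0 b1] := b01; rewrite mulr_ge0//=.
  by rewrite ler_piMl.
- exact: cvg_cst.
- by rewrite -pv0; exact: cp.
Unshelve. all: by end_near.
Qed.

(** Portmanteau for a set whose boundary lies in the null set where D vanishes.
    With q = exp (- D), the indicator of B lies between the continuous functions
    1_B (1 - q ^ k) and 1_B (1 - q ^ k) + q ^ k.  Their integrals converge, and
    their gap q ^ k has an m0-integral that tends to 0 with k, because q is
    smaller than 1 almost everywhere. *)
Lemma weak_cvg_continuity_set (R : realType) n
    (m : R -> {measure set (n.-tuple R) -> \bar R})
    (m0 : probability (n.-tuple R) R) (B : set 'rV[R]_n) (D : 'rV[R]_n -> R) :
  weak_cvg_pinfty m m0 -> measurable [set t | B (vec t)] ->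
  continuous D -> measurable_fun setT (fun t : n.-tuple R => D (vec t)) ->
  (forall v, 0 <= D v) ->
  (forall v, D v != 0 -> \forall u \near v, B u <-> B v) ->
  m0 [set t | D (vec t) = 0] = 0%E ->
  m x [set t | B (vec t)] @[x --> +oo] --> m0 [set t | B (vec t)].
Proof.
move=> cvgm mB cD mD D0 BD m0D.
set A := [set t | B (vec t)].
pose q v := expR (- D v).
have cq : continuous q.
  by move=> v; apply: continuous_comp; [exact: cvgN (cD v)|exact: continuous_expR].
have q01 v : 0 <= q v <= 1 by rewrite expR_ge0/= -expR0 ler_expR oppr_le0.
have q1E v : (q v == 1) = (D v == 0).
  by rewrite /q -expR0 (inj_eq (@expR_inj R)) oppr_eq0.
have mq : measurable_fun setT (fun t : n.-tuple R => q (vec t)).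
  apply: measurableT_comp; first exact: measurable_expR.
  exact: measurableT_comp.
pose g k v := \1_B v * (1 - q v ^+ k).
pose h k v := g k v + q v ^+ k.
have qk01 k v : 0 <= q v ^+ k <= 1.
  by have /andP[q0 q1] := q01 v; rewrite exprn_ge0// exprn_ile1.
have cg k : continuous (g k).
  by apply: continuous_indic_damped => // v; rewrite q1E; exact: BD.
have cqk k : continuous (fun v => q v ^+ k).
  by move=> v; exact: (continuous_comp (cq v) (@exprn_continuous R k _)).
have ch k : continuous (h k) by move=> v; exact: (cvgD (cg k v) (cqk k v)).
have mqk k : measurable_fun setT (fun t : n.-tuple R => q (vec t) ^+ k).
  exact: measurable_funX.
have indicA t : \1_B (vec t) = \1_A t :> R.
  by rewrite !indicE; congr (nat_of_bool _)%:R; apply/idP/idP; rewrite !inE.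
have mg k : measurable_fun setT (fun t : n.-tuple R => g k (vec t)).
  rewrite /g; under eq_fun do rewrite indicA.
  apply: measurable_funM; first exact: measurable_indic.
  exact: measurable_funB.
have mh k : measurable_fun setT (fun t : n.-tuple R => h k (vec t)).
  exact: measurable_funD.
have g0 k v : 0 <= g k v.
  by rewrite mulr_ge0 ?subr_ge0//; have /andP[] := qk01 k v.
have h0 k v : 0 <= h k v by rewrite addr_ge0//; have /andP[] := qk01 k v.
have gBh k v : g k v <= \1_B v <= h k v.
  have /andP[] := qk01 k v; rewrite /h /g indicE; case: (v \in B) => /=; lra.
have h1 k v : h k v <= 1.
  have /andP[] := qk01 k v; rewrite /h /g indicE; case: (v \in B) => /=; lra.
have sandwich k (mu : {measure set (n.-tuple R) -> \bar R}) :
    (\int[mu]_t (g k (vec t))%:E <= mu A <= \int[mu]_t (h k (vec t))%:E)%E.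
  apply: integral_sandwich => //.
have cvg_g k := cvgm (g k) (cg k).
have cvg_h k := cvgm (h k) (ch k).
have g1 k v : g k v <= 1.
  apply: le_trans (h1 k v); have /andP[gB Bh] := gBh k v; exact: le_trans gB Bh.
have {}cvg_h k : (\int[m x]_t (h k (vec t))%:E)%E @[x --> +oo] -->
    (\int[m0]_t (h k (vec t))%:E)%E.
  by apply: cvg_h; exists 1 => v; rewrite ger0_norm.
have {}cvg_g k : (\int[m x]_t (g k (vec t))%:E)%E @[x --> +oo] -->
    (\int[m0]_t (g k (vec t))%:E)%E.
  by apply: cvg_g; exists 1 => v; rewrite ger0_norm.
have int_h k : (\int[m0]_t (h k (vec t))%:E =
    \int[m0]_t (g k (vec t))%:E + \int[m0]_t (q (vec t) ^+ k)%:E)%E.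
  rewrite -ge0_integralD//.
  - by move=> t _; rewrite lee_fin.
  - exact/measurable_EFinP.
  - by move=> t _; rewrite lee_fin; have /andP[] := qk01 k (vec t).
  - exact/measurable_EFinP.
have cvg_q : (\int[m0]_t (q (vec t) ^+ k)%:E @[k --> \oo] --> 0)%E.
  apply: cvg_integral_exprn0 => //.
  rewrite -m0D; congr (m0 _); apply/seteqP; split => t /= /eqP.
    by rewrite q1E => /eqP.
  by rewrite -q1E => /eqP.
have [a m0A] : exists a, m0 A = a%:E.
  by exists (fine (m0 A)); rewrite fineK// fin_num_measure.
rewrite m0A.
suff bounds e : 0 < e ->
    \forall x \near +oo, ((a - e)%:E < m x A < (a + e)%:E)%E.
  apply/fine_cvgP; split.
    have := bounds 1 ltr01; apply: filterS => x /andP[ax xa].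
    by rewrite fin_numElt (lt_trans _ ax) ?ltNyr// (lt_trans xa) ?ltry.
  apply/cvgrPdist_lt => e /bounds; apply: filterS => x /andP[ax xa].
  have mxA : m x A \is a fin_num.
    by rewrite fin_numElt (lt_trans _ ax) ?ltNyr// (lt_trans xa) ?ltry.
  move: ax xa; rewrite /= -(fineK mxA) !lte_fin /= ltr_norml; lra.
move=> e0.
have e20 : 0 < e / 2 by rewrite divr_gt0.
have [k qk] : exists k, (\int[m0]_t (q (vec t) ^+ k)%:E < (e / 2)%:E)%E.
  have /fine_cvgP[fq /cvgrPdist_lt/(_ _ e20) dq] := cvg_q.
  have [k [fk dk]] := filter_ex (filterI fq dq).
  exists k; move: dk; rewrite -(fineK fk) lte_fin /= sub0r normrN.
  by move=> /(le_lt_trans (ler_norm _)).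
have /andP[gA Ah] : (\int[m0]_t (g k (vec t))%:E <= m0 A <=
    \int[m0]_t (h k (vec t))%:E)%E := sandwich k m0.
have [b intg] : exists b, (\int[m0]_t (g k (vec t))%:E = b%:E)%E.
  exists (fine (\int[m0]_t (g k (vec t))%:E)%E); rewrite fineK// ge0_fin_numE.
    by apply: le_lt_trans gA _; rewrite m0A ltry.
  by apply: integral_ge0 => t _; rewrite lee_fin.
have [c intq] : exists c, (\int[m0]_t (q (vec t) ^+ k)%:E = c%:E)%E.
  exists (fine (\int[m0]_t (q (vec t) ^+ k)%:E)%E); rewrite fineK// ge0_fin_numE.
    by apply: lt_trans qk _; rewrite ltry.
  by apply: integral_ge0 => t _; rewrite lee_fin; have /andP[] := qk01 k (vec t).
move: gA Ah qk; rewrite int_h intg intq m0A -EFinD !lee_fin lte_fin => ba abc ce.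
have := cvg_g k; rewrite intg => /fine_cvgP[fg /cvgrPdist_lt/(_ _ e20) dg].
have := cvg_h k; rewrite int_h intg intq -EFinD.
move=> /fine_cvgP[fh /cvgrPdist_lt/(_ _ e20) dh].
near=> x.
have /andP[gA Ah] := sandwich k (m x).
have fgx : (\int[m x]_t (g k (vec t))%:E)%E \is a fin_num by near: x.
have fhx : (\int[m x]_t (h k (vec t))%:E)%E \is a fin_num by near: x.
have dgx : `|b - fine (\int[m x]_t (g k (vec t))%:E)%E| < e / 2 by near: x.
have dhx : `|b + c - fine (\int[m x]_t (h k (vec t))%:E)%E| < e / 2 by near: x.
apply/andP; split.
- apply: lt_le_trans gA; rewrite -(fineK fgx) lte_fin.
  by move: dgx; rewrite ltr_norml; lra.
- apply: le_lt_trans Ah _; rewrite -(fineK fhx) lte_fin.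
  by move: dhx; rewrite ltr_norml; lra.
Unshelve. all: by end_near.
Qed.

Lemma measurable_threshold (R : realType) n (b : ('I_n -> bool) -> Prop) :
  measurable [set t : n.-tuple R | b (fun i => tnth t i <= 1)].
Proof.
apply: (measurable_finpred_preimage (p := fun i (t : n.-tuple R) => tnth t i <= 1)) => i.
exact: (measurable_tnth_preimage i (measurable_itv `]-oo, (1 : R)])).
Qed.

Lemma near_le1 (R : realType) (a : R) :
  a != 1 -> \forall u \near a, (u <= 1) = (a <= 1).
Proof.
move=> a1; case: (ltgtP a 1) a1 => // a1 _.
  by have := open_nbhs_nbhs (conj (@open_lt R 1) a1); apply: filterS => u /= /ltW.
have := open_nbhs_nbhs (conj (@open_gt R 1) a1); apply: filterS => u /= u1.
by rewrite leNgt u1.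
Qed.

Lemma continuous_prod_coord (R : realType) n (a : R) :
  continuous (fun v : 'rV[R]_n => \prod_i (v ord0 i - a)).
Proof.
move=> v.
have FF : Filter (nbhs (v : 'rV[R]_n)) by exact: nbhs_filter.
apply: (@cvg_big R 'I_n *%R 1 xpredT (@mul_continuous R) _ (nbhs (v : 'rV[R]_n))
  _ (fun i (u : 'rV[R]_n) => u ord0 i - a) (fun i => v ord0 i - a) FF) => i _.
have ci : continuous (fun u : 'rV[R]_n => u ord0 i) by exact: coord_continuous.
exact: (cvgB (ci v) (@cvg_cst _ a _ _ FF)).
Qed.

(** An event that depends only on which coordinates exceed 1 changes only across
    the zero set of the product of the t_i - 1, whose absolute value serves as the
    function D of the continuity-set lemma. *)
Lemma weak_cvg_threshold (R : realType) n
    (m : R -> {measure set (n.-tuple R) -> \bar R})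
    (m0 : probability (n.-tuple R) R) (b : ('I_n -> bool) -> Prop) :
  weak_cvg_pinfty m m0 ->
  m0 [set t | exists i, tnth t i = 1] = 0%E ->
  m x [set t | b (fun i => tnth t i <= 1)] @[x --> +oo] -->
  m0 [set t | b (fun i => tnth t i <= 1)].
Proof.
move=> cvgm m01.
pose B := [set v : 'rV[R]_n | b (fun i => v ord0 i <= 1)].
pose D (v : 'rV[R]_n) : R := `|\prod_i (v ord0 i - 1)|.
have BE : [set t : n.-tuple R | b (fun i => tnth t i <= 1)] = [set t | B (vec t)].
  apply/funext => t; rewrite /B /=; congr b; apply/funext => i.
  by rewrite mxE.
have D0 v : (D v == 0) = [exists i, v ord0 i == 1].
  rewrite normr_eq0 prodf_seq_eq0; apply/hasP/existsP => [[i _]|[i vi]].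
    by rewrite subr_eq0 => vi; exists i.
  by exists i; rewrite ?mem_index_enum// subr_eq0.
rewrite BE; apply: (@weak_cvg_continuity_set _ _ m m0 B D) => //.
- by rewrite -BE; exact: measurable_threshold.
- move=> v.
  exact: (continuous_comp (@continuous_prod_coord R n 1 v) (@norm_continuous R R _)).
- apply: measurableT_comp => //; apply: measurable_prod => i _.
  apply: measurable_funB => //.
  under eq_fun do rewrite mxE; exact: measurable_tnth.
- by move=> v; exact: normr_ge0.
- move=> v; rewrite D0 negb_exists => /forallP v1.
  have FF : Filter (nbhs (v : 'rV[R]_n)) by exact: nbhs_filter.
  have near_i i : nbhs v [set u : 'rV[R]_n | (u ord0 i <= 1) = (v ord0 i <= 1)].
    exact: (@coord_continuous R 1 n ord0 i v _ (near_le1 (v1 i))).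
  have := @filter_forall _ _ _ _ FF near_i.
  apply: filterS => u uv; rewrite /B /=.
  by rewrite (_ : (fun i => u ord0 i <= 1) = (fun i => v ord0 i <= 1))//; apply/funext.
- rewrite -m01; congr (m0 _); apply/seteqP; split => t /=.
    by move=> /eqP; rewrite D0 => /existsP[i]; rewrite mxE => /eqP; exists i.
  by case=> i ti; apply/eqP; rewrite D0; apply/existsP; exists i; rewrite mxE ti.
Qed.

(** * Conditional laws given an excess *)

(** Restrict P to E, push the restriction forward along Z and rescale.  When E is a
    null set, the inverse of 0 is 0 and both sides vanish. *)
Lemma conditional_law_measure d (T : measurableType d) d' (T' : measurableType d')
    (R : realType) (P : probability T R) (E : set T) (Z : T -> T') :
  measurable E -> measurable_fun setT Z ->
  exists mu : {measure set T' -> \bar R}, forall A, measurable A ->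
    mu A = (prob P [set w | E w /\ A (Z w)] / prob P E)%:E.
Proof.
move=> mE mZ.
have c0 : 0 <= (prob P E)^-1 by rewrite invr_ge0 fine_ge0.
pose nu : {measure set T' -> \bar R} :=
  measure_function_pushforward__canonical__measure_function_Measure (mrestr P mE) mZ.
exists (mscale (NngNum c0) nu) => A mA.
change (((prob P E)^-1%:E * P (Z @^-1` A `&` E))%E =
  (prob P [set w | E w /\ A (Z w)] / prob P E)%:E).
have -> : Z @^-1` A `&` E = [set w | E w /\ A (Z w)] by rewrite setIC.
have mEA : measurable [set w | E w /\ A (Z w)].
  apply: measurableI => //.
  by have := mZ measurableT A mA; rewrite setTI.
by rewrite /prob mulrC EFinM fineK// fin_num_measure.
Qed.

Lemma measurable_scale_tuple (R : realType) n (a : R) :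
  measurable_fun setT (@scale_tuple R n a).
Proof.
apply/measurable_fun_tnthP => i.
rewrite (_ : _ \o _ = fun t => a * tnth t i).
  by apply: measurable_funM => //; exact: measurable_tnth.
by apply/funext => t /=; rewrite tnth_mktuple.
Qed.

Lemma excess_law_measure d (T : measurableType d) (R : realType)
    (P : probability T R) (X : int -> {RV P >-> R}) n (ts : n.-tuple int) :
  exists mu : R -> {measure set (n.-tuple R) -> \bar R},
    forall x A, measurable A -> mu x A =
      (prob P [set w | x < X 0 w /\ A (scale_tuple x^-1 (fidi X ts w))] /
       prob P [set w | x < X 0 w])%:E.
Proof.
suff /choice[mu muE] : forall x, exists mu : {measure set (n.-tuple R) -> \bar R},
    forall A, measurable A -> mu A =
      (prob P [set w | x < X 0 w /\ A (scale_tuple x^-1 (fidi X ts w))] /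
       prob P [set w | x < X 0 w])%:E by exists mu.
move=> x; apply: (@conditional_law_measure _ _ _ _ _ P [set w | x < X 0 w]
  (fun w => scale_tuple x^-1 (fidi X ts w))).
  exact: measurable_RV_gt.
apply: measurableT_comp; first exact: measurable_scale_tuple.
exact: measurable_fidi.
Qed.

Lemma tail_process_weak_cvg d (T : measurableType d) d' (T' : measurableType d')
    (R : realType) (P : probability T R) (P' : probability T' R)
    (X : int -> {RV P >-> R}) (Y : int -> {RV P' >-> R}) (alpha : R)
    (s : int) (n : nat) :
  tail_process X Y alpha -> (2 <= n)%N ->
  exists mu : R -> {measure set (n.-tuple R) -> \bar R},
    (forall x A, measurable A -> mu x A =
      (prob P [set w | x < X 0 w /\
                       A (scale_tuple x^-1 (fidi X (segment s n) w))] /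
       prob P [set w | x < X 0 w])%:E) /\
    weak_cvg_pinfty mu (fidi_law Y (segment s n)).
Proof.
move=> [_ XY] n2; have [mu muE] := @excess_law_measure _ _ _ _ X n (segment s n).
exists mu; split => //.
apply: weak_cvg_pinfty_eq_measurable (XY s n n2) => x A mA.
by rewrite muE.
Qed.

(** * The tail process is nonnegative *)

(** The marginal distribution function vanishes at b - 1, below its lower endpoint
    b; stationarity carries this from time 0 to every time. *)
Lemma stationary_lower_bound d (T : measurableType d) (R : realType)
    (P : probability T R) (X : int -> {RV P >-> R}) :
  strictly_stationary X -> lower_endpoint_finite (marginal_df X) ->
  exists c : R, forall t, P [set w | X t w <= c] = 0%E.
Proof.
move=> Xst [b lb_b]; exists (b - 1) => t.
have P0 : P [set w | X 0 w <= b - 1] = 0%E.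
  apply/eqP; rewrite eq_le measure_ge0 andbT leNgt; apply/negP => Ppos.
  have : b <= b - 1.
    apply: lb_b; rewrite /= /marginal_df /cdf /distribution /pushforward.
    have -> : X 0 @^-1` `]-oo, b - 1] = [set w | X 0 w <= b - 1].
      by apply/seteqP; split => w /=; rewrite in_itv.
    rewrite -lte_fin fineK// fin_num_measure//; exact: measurable_RV_le.
  lra.
have mA : measurable [set s : 1.-tuple R | tnth s ord0 <= b - 1].
  exact: (measurable_tnth_preimage ord0 (measurable_itv `]-oo, b - 1])).
have lawE h (ts : 1.-tuple int) : tnth ts ord0 = h ->
    fidi_law X ts [set s | tnth s ord0 <= b - 1] = P [set w | X h w <= b - 1].
  move=> tsh; change (P (fidi X ts @^-1` [set s | tnth s ord0 <= b - 1]) =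
    P [set w | X h w <= b - 1]).
  by congr (P _); apply/seteqP; split => w /=; rewrite /fidi tnth_mktuple tsh.
have := Xst 1%N [tuple 0] t _ mA.
rewrite (lawE t); last by rewrite tnth_mktuple (tnth_nth 0) add0r.
by rewrite (lawE 0) ?P0// (tnth_nth 0).
Qed.

(** Almost surely X_t / x is larger than c / x, which tends to 0.  The
    test function phi a = 1 - exp (a - |a|) is bounded, continuous, zero exactly on
    the nonnegative reals and at most |a| - a; its conditional expectations hence
    tend to 0, so phi (Y_t) has expectation 0. *)
Lemma tail_process_ge0 d (T : measurableType d) d' (T' : measurableType d')
    (R : realType) (P : probability T R) (P' : probability T' R)
    (X : int -> {RV P >-> R}) (Y : int -> {RV P' >-> R}) (alpha c : R) :
  (forall t, P [set w | X t w <= c] = 0%E) -> tail_process X Y alpha ->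
  forall t, P' [set w | Y t w < 0] = 0%E.
Proof.
move=> Xc XY t.
have [mu [muE cvgmu]] := tail_process_weak_cvg t XY (isT : (2 <= 2)%N).
pose phi (a : R) := 1 - expR (a - `|a|).
pose f (v : 'rV[R]_2) := phi (v ord0 ord0).
have phi0 a : 0 <= phi a.
  by rewrite subr_ge0 -expR0 ler_expR subr_le0 ler_norm.
have phi1 a : phi a <= 1 by rewrite gerBl expR_ge0.
have phiE a : phi a = 0 -> 0 <= a.
  move=> /eqP; rewrite subr_eq0 eq_sym -expR0 (inj_eq (@expR_inj R)) subr_eq0.
  by move=> /eqP ->.
have phi_le a e : 0 < e -> - (e / 2) <= a -> phi a <= e.
  move=> e0 ea; have := expR_ge1Dx (a - `|a|); rewrite /phi.
  by case: (ler0P a); lra.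
have cphi : continuous phi.
  have cabs : continuous (fun a : R => a - `|a|).
    by move=> a; apply: cvgB; [exact: cvg_id|exact: norm_continuous].
  move=> a; apply: cvgB; first exact: cvg_cst.
  exact: (continuous_comp (cabs a) (@continuous_expR R _)).
have cf : continuous f.
  move=> v; exact: (continuous_comp (@coord_continuous R 1 2 ord0 ord0 v) (cphi _)).
have mphi : measurable_fun setT phi.
  apply: measurable_funB => //; apply: measurableT_comp => //.
  exact: measurable_funB.
have mt : measurable_fun setT (fun s : 2.-tuple R => tnth s ord0).
  exact: measurable_tnth.
have mf : measurable_fun setT (fun s : 2.-tuple R => f (vec s)).
  rewrite (_ : (fun _ => _) = phi \o (fun s : 2.-tuple R => tnth s ord0)).
    exact: measurableT_comp.
  by apply/funext => s; rewrite /f /= mxE.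
have mfE := (measurable_EFinP _ _).2 mf.
have cvg_f : (\int[mu x]_s (f (vec s))%:E)%E @[x --> +oo] -->
    (\int[fidi_law Y (segment t 2)]_s (f (vec s))%:E)%E.
  by apply: cvgmu => //; exists 1 => v; rewrite ger0_norm// /f.
have int0 : (\int[fidi_law Y (segment t 2)]_s (f (vec s))%:E)%E = 0%E.
  apply/eqP; rewrite eq_le integral_ge0 ?andbT//; last first.
    by move=> s _; rewrite lee_fin /f.
  apply/lee_addgt0Pr => e e0; rewrite add0e.
  apply: (cvge_to_le cvg_f); near=> x.
  have x0 : 0 < x by near: x; exact: nbhs_pinfty_gt.
  (* With this margin phi_le bounds phi by e beyond c / x. *)
  have cx : - (e / 2) <= c / x.
    have : 2 * `|c| / e <= x by near: x; apply: nbhs_pinfty_ge; exact: num_real.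
    rewrite ler_pdivrMr// ler_pdivlMr//.
    have := ler_norm (- c); rewrite normrN; nra.
  have mA : measurable [set s : 2.-tuple R | tnth s ord0 <= c / x].
    exact: (measurable_tnth_preimage ord0 (measurable_itv `]-oo, c / x])).
  apply: (@le_trans _ _ (\int[mu x]_s (cst e%:E s))%E).
    apply: ae_ge0_le_integral => //.
    - by move=> s _; rewrite lee_fin /f.
    - by move=> s _; rewrite lee_fin ltW.
    exists [set s : 2.-tuple R | tnth s ord0 <= c / x]; split => //.
      rewrite muE// /prob (_ : [set w | _] =
          [set w | x < X 0 w] `&` [set w | X t w <= c]).
        rewrite (measure0_subset (B := [set w | X t w <= c])) ?mul0r//.
        - by apply: measurableI; [exact: measurable_RV_gt|exact: measurable_RV_le].
        - exact: measurable_RV_le.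
        - exact: Xc.
      apply/seteqP; split => w; rewrite /= !tnth_mktuple addr0 mulrC;
        by rewrite ler_pM2r ?invr_gt0.
    move=> s /=; apply: contra_notT; rewrite -ltNge => cs _.
    rewrite lee_fin /f mxE; apply: phi_le => //.
    exact: le_trans cx (ltW cs).
  rewrite integral_cst// muE// -EFinM lee_fin.
  rewrite (_ : [set w | _ /\ _] = [set w | x < X 0 w]); last first.
    by apply/seteqP; split => w //= [].
  rewrite ler_piMr ?(ltW e0)//; set p := prob P _.
  by have [->|p0] := eqVneq p 0; rewrite ?invr0 ?mulr0// divff.
have := (ae_eq_integral_abs (fidi_law Y (segment t 2)) measurableT mfE).1.
case=> [|N [mN N0 fN]].
  by rewrite -int0; apply: eq_integral => s _; rewrite gee0_abs// lee_fin /f.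
have mA : measurable [set s : 2.-tuple R | tnth s ord0 < 0].
  exact: (measurable_tnth_preimage ord0 (measurable_itv `]-oo, (0 : R)[)).
transitivity (fidi_law Y (segment t 2) [set s | tnth s ord0 < 0]).
  change (P' [set w | Y t w < 0] =
    P' (fidi Y (segment t 2) @^-1` [set s | tnth s ord0 < 0])).
  by congr (P' _); apply/seteqP; split => w; rewrite /= !tnth_mktuple addr0.
apply: (measure0_subset (B := N)) => // s /= s0; apply: fN => /= /(_ Logic.I).
move=> -[] /phiE; rewrite mxE; move: s0; rewrite ltNge => /negP.
exact.
Unshelve. all: by end_near.
Qed.

(** * Threshold patterns of the tail process *)

(** Dividing by x turns comparisons of X with x into comparisons with 1, so the
    weak convergence that defines Y applies to patterns of exceedances. *)
Lemma tail_process_threshold_cvg d (T : measurableType d) d' (T' : measurableType d')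
    (R : realType) (P : probability T R) (P' : probability T' R)
    (X : int -> {RV P >-> R}) (Y : int -> {RV P' >-> R}) (alpha : R)
    (s : int) (n : nat) (b : ('I_n -> bool) -> Prop) :
  tail_process X Y alpha -> (2 <= n)%N ->
  P' [set w | exists i : 'I_n, Y (s + (i : nat)%:Z) w = 1] = 0%E ->
  prob P [set w | x < X 0 w /\ b (fun i => X (s + (i : nat)%:Z) w <= x)] /
    prob P [set w | x < X 0 w] @[x --> +oo] -->
  prob P' [set w | b (fun i => Y (s + (i : nat)%:Z) w <= 1)].
Proof.
move=> XY n2 Y1.
have [mu [muE cvgmu]] := tail_process_weak_cvg s XY n2.
have tnthE d0 (T0 : measurableType d0) (P0 : probability T0 R)
    (Z : int -> {RV P0 >-> R}) w (i : 'I_n) :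
    tnth (fidi Z (segment s n) w) i = Z (s + (i : nat)%:Z) w.
  by rewrite !tnth_mktuple.
set A := [set t : n.-tuple R | b (fun i => tnth t i <= 1)].
have mA : measurable A by exact: measurable_threshold.
have lawA : fidi_law Y (segment s n) A =
    P' [set w | b (fun i => Y (s + (i : nat)%:Z) w <= 1)].
  change (P' (fidi Y (segment s n) @^-1` A) =
    P' [set w | b (fun i => Y (s + (i : nat)%:Z) w <= 1)]).
  congr (P' _); apply/funext => w; rewrite /A /=; congr b.
  by apply/funext => i; rewrite tnthE.
have law1 : fidi_law Y (segment s n) [set t | exists i, tnth t i = 1] = 0%E.
  rewrite -Y1.
  change (P' (fidi Y (segment s n) @^-1` [set t | exists i, tnth t i = 1]) =
    P' [set w | exists i : 'I_n, Y (s + (i : nat)%:Z) w = 1]).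
  by congr (P' _); apply/seteqP; split => w [i]; rewrite ?tnthE => Yi; exists i;
    rewrite ?tnthE.
have := weak_cvg_threshold (b := b) cvgmu law1.
have fA : fidi_law Y (segment s n) A \is a fin_num by rewrite fin_num_measure.
rewrite -/A -(fineK fA) => /fine_cvg; rewrite lawA; apply: cvg_trans.
apply: near_eq_cvg; near=> x.
have x0 : 0 < x by near: x; exact: nbhs_pinfty_gt.
rewrite /= muE//=; congr (prob P _ / _).
apply/funext => w /=; congr (_ /\ b _); apply/funext => i.
by rewrite tnth_mktuple tnthE ler_pdivrMl// mulr1.
Unshelve. all: by end_near.
Qed.

(** The critical set contains only nonnegative vectors; almost sure nonnegativity
    of Y is what makes its nullity cover every path that hits 1. *)
Lemma hits_one_eq0 d (T : measurableType d) (R : realType) (P : probability T R)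
    (Y : int -> {RV P >-> R}) n (s : int) :
  {ae P, forall w, forall k : nat, 0 <= Y (s + k%:Z) w} ->
  fidi_law Y (segment s n) (@critical_set R n) = 0%E ->
  P [set w | exists i : 'I_n, Y (s + (i : nat)%:Z) w = 1] = 0%E.
Proof.
move=> Y0 crit0.
pose C := [set w | forall i : 'I_n, 0 <= Y (s + (i : nat)%:Z) w] `&`
  [set w | exists i : 'I_n, Y (s + (i : nat)%:Z) w == 0 \/ Y (s + (i : nat)%:Z) w == 1].
have mC : measurable C.
  apply: measurableI.
    apply: (measurable_finpred_preimage
      (p := fun (i : 'I_n) w => 0 <= Y (s + (i : nat)%:Z) w)
      (fun f => forall i, f i)) => i.
    exact: measurable_RV_ge.
  have -> : [set w | exists i : 'I_n,
      Y (s + (i : nat)%:Z) w == 0 \/ Y (s + (i : nat)%:Z) w == 1] =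
      \bigcup_(i in [set: 'I_n]) [set w | [set (0 : R); 1] (Y (s + (i : nat)%:Z) w)].
    by apply/seteqP; split => w [i]; [move=> Yi; exists i => //|move=> _ Yi; exists i];
      case: Yi => [/eqP|/eqP] Yi; rewrite /= ?Yi ?eqxx; [left|right|left|right].
  apply: fin_bigcup_measurable => // i _; apply: measurable_RV_preimage.
  by apply: measurableU; exact: measurable_set1.
have PC : P C = 0%E.
  rewrite -crit0.
  change (P C = P (fidi Y (segment s n) @^-1` (@critical_set R n))).
  congr (P _); apply/seteqP; split => w.
    case=> Y0w [i Yi]; split => [j|]; first by rewrite !tnth_mktuple; exact: Y0w.
    by exists i; rewrite !tnth_mktuple; case: Yi => /eqP Yi; [left|right].
  case=> Y0w [i Yi]; split => [j|]; first by have := Y0w j; rewrite !tnth_mktuple.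
  by exists i; move: Yi; rewrite !tnth_mktuple; case=> /eqP Yi; [left|right].
have aeC : {ae P, forall w, ~ C w} by exists C; split => // w /contrapT.
rewrite -(measure0 P); apply: measure_eq_negligible => //.
  have -> : [set w | exists i : 'I_n, Y (s + (i : nat)%:Z) w = 1] =
      \bigcup_(i in [set: 'I_n]) [set w | [set (1 : R)] (Y (s + (i : nat)%:Z) w)].
    by apply/seteqP; split => w [i]; [exists i|move=> _ ?; exists i].
  by apply: fin_bigcup_measurable => // i _; apply: measurable_RV_preimage.
apply: filterS2 Y0 aeC => w Y0w Cw; split => // -[i Yi].
by apply: Cw; split => [j|]; [exact: Y0w|exists i; right; apply/eqP].
Qed.

(** * Cluster and start events as threshold patterns *)

Definition cluster_pattern l (f : 'I_l.+2 -> bool) : Prop :=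
  [/\ f ord0, forall i : 'I_l.+2, (0 < i < l.+1)%N -> ~~ f i & f ord_max].

(** Start events are read on the same l + 2 coordinates as cluster events, so that
    the null critical set of that length serves for both. *)
Definition start_pattern l (f : 'I_l.+2 -> bool) : Prop :=
  f ord0 /\ ~~ f (lift ord0 ord0).

Lemma cluster_eventE d (T : measurableType d) (R : realType) (P : probability T R)
    (Z : int -> {RV P >-> R}) u l :
  cluster_event Z u l =
  [set w | cluster_pattern (fun i : 'I_l.+2 => Z (-1 + (i : nat)%:Z) w <= u)].
Proof.
have succE (k : nat) : -1 + k.+1%:Z = k%:Z by rewrite -addn1 PoszD addrC addrK.
apply/seteqP; split => w [Z0 Zi Zl]; split => //=.
- by case=> -[|k] //= kl kl1; rewrite -ltNge succE; exact: Zi.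
- by rewrite succE.
- move=> k kl; have kl2 : (k.+1 < l.+2)%N by rewrite ltnS ltnW.
  by have := Zi (Ordinal kl2) kl; rewrite -ltNge /= succE.
- by move: Zl; rewrite /= succE.
Qed.

Lemma start_eventE d (T : measurableType d) (R : realType) (P : probability T R)
    (Z : int -> {RV P >-> R}) u l :
  start_event Z u =
  [set w | start_pattern (fun i : 'I_l.+2 => Z (-1 + (i : nat)%:Z) w <= u)].
Proof. by apply/seteqP; split => w [Z0 Z1]; split; rewrite // ?ltNge // -ltNge. Qed.

Lemma measurable_pattern d (T : measurableType d) (R : realType)
    (P : probability T R) (Z : int -> {RV P >-> R}) u l
    (b : ('I_l -> bool) -> Prop) :
  measurable [set w | b (fun i => Z (-1 + (i : nat)%:Z) w <= u)].
Proof.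
apply: (measurable_finpred_preimage
  (p := fun (i : 'I_l) w => Z (-1 + (i : nat)%:Z) w <= u)) => i.
exact: measurable_RV_le.
Qed.

(** The box also asks the two outer coordinates to be nonnegative, which Y
    satisfies almost surely. *)
Lemma cluster_box_law d (T : measurableType d) (R : realType)
    (P : probability T R) (Y : int -> {RV P >-> R}) l :
  {ae P, forall w, forall k : nat, 0 <= Y (-1 + k%:Z) w} ->
  fidi_law Y (segment (-1) l.+2) (@cluster_box R l) = P (cluster_event Y 1 l).
Proof.
move=> Y0.
change (P (fidi Y (segment (-1) l.+2) @^-1` (@cluster_box R l)) =
  P (cluster_event Y 1 l)).
rewrite cluster_eventE.
have -> : fidi Y (segment (-1) l.+2) @^-1` (@cluster_box R l) =
    [set w | cluster_pattern (fun i : 'I_l.+2 => Y (-1 + (i : nat)%:Z) w <= 1)] `&`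
    ([set w | ~ Y (-1 + 0%:Z) w < 0] `&` [set w | ~ Y (-1 + l.+1%:Z) w < 0]).
  apply/seteqP; split => w.
    case; rewrite !tnth_mktuple => /andP[Y00 Y01] Yi /andP[Yl0 Yl1].
    split; last by split => /=; rewrite ltNge; apply/negP; rewrite negbK.
    split => // i il /=; have := Yi i il; rewrite !tnth_mktuple -ltNge //.
  case=> -[Y01 Yi Yl1] [/negP Y00 /negP Yl0]; split; rewrite ?tnth_mktuple.
  - by rewrite /= leNgt Y00 Y01.
  - by move=> i il; have := Yi i il; rewrite !tnth_mktuple /= ltNge.
  - by rewrite /= leNgt Yl0 Yl1.
have mge0 t : measurable [set w | ~ Y t w < 0].
  exact/measurableC/measurable_RV_lt.
apply: measure_eq_negligible.
- apply: measurableI; first exact: measurable_pattern.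
  by apply: measurableI; exact: mge0.
- exact: measurable_pattern.
apply: filterS Y0 => w Y0; split => [[]//|cw]; split => //.
by split => /=; apply/negP; rewrite -leNgt.
Qed.

Lemma start_box_law d (T : measurableType d) (R : realType)
    (P : probability T R) (Y : int -> {RV P >-> R}) :
  {ae P, forall w, forall k : nat, 0 <= Y (-1 + k%:Z) w} ->
  fidi_law Y (segment (-1) 2) (@start_box R) = P (start_event Y 1).
Proof.
move=> Y0.
change (P (fidi Y (segment (-1) 2) @^-1` (@start_box R)) = P (start_event Y 1)).
rewrite (start_eventE Y 1 0).
have -> : fidi Y (segment (-1) 2) @^-1` (@start_box R) =
    [set w | start_pattern (fun i : 'I_2 => Y (-1 + (i : nat)%:Z) w <= 1)] `&`
    [set w | ~ Y (-1 + 0%:Z) w < 0].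
  apply/seteqP; split => w.
    case; rewrite !tnth_mktuple => /andP[Y00 Y01] Yi.
    split; last by rewrite /= ltNge; apply/negP; rewrite negbK.
    by split => //; rewrite -ltNge.
  case=> -[Y01 Yi] /negP Y00; split; rewrite ?tnth_mktuple.
    by rewrite /= leNgt Y00 Y01.
  by move: Yi; rewrite /= -ltNge.
have mge0 t : measurable [set w | ~ Y t w < 0].
  exact/measurableC/measurable_RV_lt.
apply: measure_eq_negligible.
- by apply: measurableI; [exact: measurable_pattern|exact: mge0].
- exact: measurable_pattern.
apply: filterS Y0 => w Y0; split => [[]//|cw]; split => //.
by apply/negP; rewrite -leNgt.
Qed.

(** * Limit law of the cluster size *)

Theorem mainTheorem1 (R : realType)
  (d : measure_display) (T : measurableType d) (P : probability T R)
  (X : int -> {RV P >-> R})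
  (d' : measure_display) (T' : measurableType d') (P' : probability T' R)
  (Y : int -> {RV P' >-> R})
  (dC : measure_display) (TC : R -> measurableType dC)
  (Q : forall u : R, probability (TC u) R)
  (C : forall u : R, {RV (Q u) >-> nat})
  (alpha : R) (alpha_gt0 : 0 < alpha)
  (X_stationary : strictly_stationary X)
  (X_lower : lower_endpoint_finite (marginal_df X))
  (X_MDA : frechet_MDA (marginal_df X) alpha)
  (X_regvar : regularly_varying X alpha)
  (Y_tail : tail_process X Y alpha)
  (start_gt0 : (0 < fidi_law Y (segment (-1) 2) (@start_box R))%E)
  (critical0 : forall l : nat, (1 <= l)%N ->
    fidi_law Y (segment (-1) l.+2) (@critical_set R l.+2) = 0%E)
  (C_law : forall u : R, 0 < prob P (start_event X u) ->
    cluster_size_law X u (C u)) :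
  forall l : nat, (1 <= l)%N ->
    (prob (Q u) [set w | C u w = l] @[u --> +oo] -->
       prob P' (cluster_event Y 1 l) / prob P' (start_event Y 1)) /\
    prob P' (cluster_event Y 1 l) / prob P' (start_event Y 1) =
      prob (fidi_law Y (segment (-1) l.+2)) (@cluster_box R l) /
      prob (fidi_law Y (segment (-1) 2)) (@start_box R).
Proof.
move=> l l1.
have [c Xc] := stationary_lower_bound X_stationary X_lower.
have Y_neg := tail_process_ge0 Xc Y_tail.
have Y0 : {ae P', forall w, forall k : nat, 0 <= Y (-1 + k%:Z) w}.
  have nonneg_at t : {ae P', forall w, 0 <= Y t w}.
    exists [set w | Y t w < 0]; split => //; first exact: measurable_RV_lt.
    by move=> w /negP; rewrite -ltNge.
  exact: ae_foralln.
have Y1 := hits_one_eq0 Y0 (critical0 l l1).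
have cvgC := tail_process_threshold_cvg (b := @cluster_pattern l) Y_tail isT Y1.
have cvgS := tail_process_threshold_cvg (b := @start_pattern l) Y_tail isT Y1.
have startE := start_box_law Y0.
rewrite -cluster_eventE -start_eventE in cvgC cvgS.
have start_pos : 0 < prob P' (start_event Y 1).
  rewrite -lte_fin fineK ?startE// -?startE//.
  by rewrite startE fin_num_measure// (start_eventE Y 1 0); exact: measurable_pattern.
split; last by rewrite /prob startE cluster_box_law.
(* For l >= 1 a cluster event forces X 0 above u, so intersecting it with the
   conditioning event changes nothing. *)
have {}cvgC : prob P (cluster_event X u l) / prob P [set w | u < X 0 w]
    @[u --> +oo] --> prob P' (cluster_event Y 1 l).
  apply: cvg_trans cvgC; apply: near_eq_cvg; apply: nearW => u /=.
  have cluster_sub : cluster_event X u l `<=` [set w | u < X 0 w].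
    by move=> w [_ X0 _]; exact: X0 0%N l1.
  by rewrite -(setIidr cluster_sub) cluster_eventE.
have {}cvgS : prob P (start_event X u) / prob P [set w | u < X 0 w]
    @[u --> +oo] --> prob P' (start_event Y 1).
  apply: cvg_trans cvgS; apply: near_eq_cvg; apply: nearW => u /=.
  have start_sub : start_event X u `<=` [set w | u < X 0 w] by move=> w [].
  by rewrite -(setIidr start_sub) (start_eventE X u l).
(* The conditioning probability cancels from the quotient. *)
have ratio_cvg : (prob P (cluster_event X u l) / prob P [set w | u < X 0 w]) /
    (prob P (start_event X u) / prob P [set w | u < X 0 w]) @[u --> +oo] -->
    prob P' (cluster_event Y 1 l) / prob P' (start_event Y 1).
  exact: cvgM cvgC (cvgV (lt0r_neq0 start_pos) cvgS).
apply: cvg_trans ratio_cvg; apply: near_eq_cvg; near=> u.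
have ratio0 : 0 < prob P (start_event X u) / prob P [set w | u < X 0 w].
  by near: u; exact: cvgr_gt start_pos.
have p0 : prob P [set w | u < X 0 w] != 0.
  by apply: contraTneq ratio0 => ->; rewrite invr0 mulr0 ltxx.
have pgt0 : 0 < prob P [set w | u < X 0 w] by rewrite lt0r p0 fine_ge0.
have S0 : 0 < prob P (start_event X u).
  by rewrite -(pmulr_lgt0 _ (_ : 0 < (prob P [set w | u < X 0 w])^-1)) ?invr_gt0.
rewrite /= (C_law u S0 l l1) invfM invrK; field.
by rewrite p0 lt0r_neq0.
Unshelve. all: by end_near.
Qed.
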